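(* Let $K$ be a number field of degree $n$ whose unit group $\mathcal O_K^*$ has rank $r\geq 1$, let $\mathfrak a$ be a nonzero ideal of $\mathcal O_K$, let $B\ge1$ be a real number, fix a system of fundamental units $\boldsymbol\epsilon=\{\epsilon_1,\ldots,\epsilon_r\}$ in $K$, and fix a set $\mathcal I(\mathfrak a,B)$ as in the context. Let $g_1,\ldots,g_t$ be all the numbers of the form $g=\epsilon_1^{n_1}\cdots\epsilon_r^{n_r}y$ with $y\in\mathcal I(\mathfrak a,B)$ and $(n_1,\ldots,n_r)\in\mathbb Z^r\cap T^{-1}(\mathcal U(\mathfrak a,B))$ satisfying $\Phi(g)\in\mathcal P(\mathfrak a,B)$. Then the numbers $0,g_1,\ldots,g_t$ form a complete set of representatives for the orbit space $\mathcal C(\mathfrak a,B)/\mu_K$.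
   Context: $\mathrm N(\mathfrak a)$ denotes the norm of $\mathfrak a$; $\mu_K$ is the group of roots of unity in $K$. Let $\sigma_1,\ldots,\sigma_{r_1}$ be the real embeddings of $K$ and $\tau_1,\overline{\tau_1},\ldots,\tau_{r_2},\overline{\tau_{r_2}}$ the pairs of complex conjugate embeddings; $r=r_1+r_2-1$. The archimedean places are ordered $v_1,\ldots,v_{r+1}$, corresponding to $\sigma_1,\ldots,\sigma_{r_1},\tau_1,\ldots,\tau_{r_2}$. For $v|\infty$ put $n_v=1$ (real) or $2$ (complex), $\sigma_v:K\to K_v\in\{\mathbb R,\mathbb C\}$ for the corresponding embedding, and $\|x\|_v=|\sigma_v(x)|^{n_v}$. $\Phi:K\to\prod_{v|\infty}K_v$ is $x\mapsto(\sigma_v(x))_v$. Units: $\Lambda:K^*\to\mathbb R^{r+1}$, $\Lambda(x)=(\log\|x\|_{v_1},\ldots,\log\|x\|_{v_{r+1}})$. A system of fundamental units is a collection $\{\epsilon_1,\ldots,\epsilon_r\}\subset\mathcal O_K^*$ such that the $\Lambda(\epsilon_j)$ form a basis of the lattice $\Lambda(\mathcal O_K^* )$. Put $F(\boldsymbol\epsilon)=\{\sum_jt_j\Lambda(\epsilon_j):|t_j|\le1/2\text{ for all }j\}$ and $D_v=\max_{\eta\in F(\boldsymbol\epsilon)}\eta_v$. $\mathcal P(\mathfrak a,B)$ is the set of $(s_v)\in\prod_{v|\infty}K_v$ with $|s_v|\le(B\,\mathrm N(\mathfrak a))^{1/n}\exp(D_v/n_v)$ for all $v|\infty$, and $\mathcal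 C(\mathfrak a,B)=\{x\in\mathfrak a:\Phi(x)\in\mathcal P(\mathfrak a,B),\ |N_{K/\mathbb Q}(x)|\le B\cdot\mathrm N(\mathfrak a)\}$, on which $\mu_K$ acts by multiplication. $\mathcal I(\mathfrak a,B)$ is a set of generators for all the nonzero principal ideals of $\mathcal O_K$ that are contained in $\mathfrak a$ and have norm at most $B\cdot\mathrm N(\mathfrak a)$, exactly one generator for each such ideal. For $v|\infty$, $A_v=\min_{y\in\mathcal I(\mathfrak a,B)}\Lambda(y)_v$ (if $\mathcal I(\mathfrak a,B)$ is empty, put $A_v=0$) and $L_v=(n_v/n)(\log B+\log\mathrm N(\mathfrak a))+D_v-A_v$. $\mathcal U(\mathfrak a,B)\subset\mathbb R^r$ is the set of $(t_1,\ldots,t_r)$ with $t_j\le L_{v_j}$ for $1\le j\le r$ and $t_1+\cdots+t_r\ge-L_{v_{r+1}}$. $\tilde\Lambda:K^*\to\mathbb R^r$ is $\Lambda$ followed by deleting the last coordinate, and $T$ is the (invertible) $r\times r$ matrix with columns $\tilde\Lambda(\epsilon_1),\ldots,\tilde\Lambda(\epsilon_r)$. *)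

(* Defs.v *)
From HB Require Import structures.
From mathcomp Require Import all_boot all_order all_algebra all_field.
From mathcomp Require Import finmap.
From mathcomp Require Import all_classical all_reals all_analysis.
From mathcomp Require Import complex.

Set Implicit Arguments.
Unset Strict Implicit.
Unset Printing Implicit Defensive.

Import Order.TTheory GRing.Theory Num.Theory.

Local Open Scope classical_set_scope.
Local Open Scope ring_scope.

(* A number field is a [K : fieldExtType rat]; ideals and the ring of integers
   are sets of elements of K. *)

Definition ring_of_integers (K : fieldExtType rat) : set K :=
  [set x | integralOver (intr : int -> K) x].

Definition unit_group (K : fieldExtType rat) : set K :=
  [set u | [/\ u != 0, ring_of_integers u & ring_of_integers u^-1]].

Definition roots_of_unity (K : fieldExtType rat) : set K :=
  [set z | exists2 m : nat, (0 < m)%N & z ^+ m = 1].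

Definition degree (K : fieldExtType rat) : nat := (\dim {:K})%VS.

(* N_{K/Q}(x): the determinant of the Q-linear map y |-> x * y on K. *)
Definition field_norm (K : fieldExtType rat) (x : K) : rat :=
  \det (passmx.mxof (vbasis {:K}) (vbasis {:K}) (amull x)).

Record is_ideal (K : fieldExtType rat) (a : set K) : Prop := IsIdeal {
  ideal_sub : a `<=` @ring_of_integers K;
  ideal_0 : a 0;
  ideal_D : forall x y, a x -> a y -> a (x + y);
  ideal_M : forall x y, ring_of_integers x -> a y -> a (x * y) }.

Definition principal_ideal (K : fieldExtType rat) (y : K) : set K :=
  [set x * y | x in @ring_of_integers K].

Definition residue_class (K : fieldExtType rat) (a : set K) (x : K) : set K :=
  [set y | a (y - x)].

(* The absolute norm N(a), i.e. the number of elements of O_K / a. *)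
Definition ideal_norm (K : fieldExtType rat) (a : set K) : nat :=
  #|` fset_set (residue_class a @` @ring_of_integers K)|.

(* An ordered choice of the archimedean places of K: the real embeddings, and
   one embedding out of each pair of complex conjugate embeddings. The index r
   is r_1 + r_2 - 1. *)
Record arch_embeddings (K : fieldExtType rat) (R : realType) (r : nat) :=
  ArchEmbeddings {
  nreal : nat;
  ncomplex : nat;
  nplaces : r.+1 = (nreal + ncomplex)%N;
  real_emb : 'I_nreal -> {rmorphism K -> R};
  complex_emb : 'I_ncomplex -> {rmorphism K -> R[i]};
  real_emb_inj : forall i j, real_emb i =1 real_emb j -> i = j;
  real_emb_all : forall f : {rmorphism K -> R}, exists i, f =1 real_emb i;
  complex_emb_inj : forall i j, complex_emb i =1 complex_emb j -> i = j;
  (* for i = j: the embeddings tau_j are not real *)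
  complex_emb_conj : forall i j, ~ (complex_emb i =1 conjc \o complex_emb j);
  complex_emb_all : forall f : {rmorphism K -> R[i]},
    ~ (f =1 conjc \o f) ->
    exists j, f =1 complex_emb j \/ f =1 conjc \o complex_emb j }.

Section Places.
Context (K : fieldExtType rat) (R : realType) (r : nat).
Context (E : arch_embeddings K R r).

(* The places v_1, ..., v_{r+1} are indexed by 'I_r.+1, the first r_1 of them
   being real. *)
Definition place_split (v : 'I_r.+1) : 'I_(nreal E) + 'I_(ncomplex E) :=
  fintype.split (cast_ord (nplaces E) v).

Definition local_degree (v : 'I_r.+1) : nat :=
  if place_split v is inl _ then 1%N else 2%N.

Definition completion_of (p : 'I_(nreal E) + 'I_(ncomplex E)) : Type :=
  if p is inl _ then R : Type else R[i].

Definition completion (v : 'I_r.+1) : Type := completion_of (place_split v).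

Definition embedding (v : 'I_r.+1) (x : K) : completion v :=
  match place_split v as p return completion_of p with
  | inl i => real_emb i x
  | inr j => complex_emb j x
  end.

Definition completion_abs (v : 'I_r.+1) : completion v -> R :=
  match place_split v as p return completion_of p -> R with
  | inl _ => fun s : R => `|s|
  | inr _ => fun s : R[i] => ComplexField.Normc.normc s
  end.

Definition place_norm (v : 'I_r.+1) (x : K) : R :=
  completion_abs (embedding v x) ^+ local_degree v.

Definition Phi (x : K) : forall v : 'I_r.+1, completion v :=
  fun v => embedding v x.

Definition Lambda (x : K) : 'cV[R]_r.+1 := \col_v ln (place_norm v x).

Definition Lambda_tilde (x : K) : 'cV[R]_r := row' ord_max (Lambda x).

End Places.

(* b is a basis of the subgroup L of V as a Z-module. *)
Definition is_Z_basis (V : zmodType) (I : finType) (L : set V) (b : I -> V) :=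
  (forall j, L (b j)) /\
  forall w, L w -> exists! k : {ffun I -> int}, w = \sum_j b j *~ k j.

Definition fundamental_units (K : fieldExtType rat) (R : realType) (r : nat)
    (E : arch_embeddings K R r) (eps : 'I_r -> K) : Prop :=
  (forall j, unit_group (eps j)) /\
  is_Z_basis (Lambda E @` @unit_group K) (fun j => Lambda E (eps j)).

(* The default value 0 is taken in particular by the minimum of the empty
   set. *)
Definition set_min (R : realType) (S : set R) : R := xget 0 (S `&` lbound S).
Definition set_max (R : realType) (S : set R) : R := xget 0 (S `&` ubound S).

Section Algorithm.
Context (K : fieldExtType rat) (R : realType) (r : nat).
Context (E : arch_embeddings K R r) (eps : 'I_r -> K).

Definition F_domain : set 'cV[R]_r.+1 :=
  [set \sum_j t j *: Lambda E (eps j) | t in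
     [set t : 'I_r -> R | forall j, `|t j| <= 2^-1]].

Definition D_bound (v : 'I_r.+1) : R :=
  set_max [set eta v 0 | eta in F_domain].

Definition P_box (a : set K) (B : R) : set (forall v, completion E v) :=
  [set s | forall v, completion_abs (s v) <=
     (B * (ideal_norm a)%:R) `^ ((degree K)%:R^-1) *
     expR (D_bound v / (local_degree E v)%:R)].

Definition C_set (a : set K) (B : R) : set K :=
  [set x | [/\ a x, P_box a B (Phi E x) &
     `|ratr (field_norm x)| <= B * (ideal_norm a)%:R]].

Definition bounded_principal_ideals (a : set K) (B : R) : set (set K) :=
  [set J | exists y : K,
     [/\ ring_of_integers y, y != 0, J = principal_ideal y, J `<=` a &
       (ideal_norm J)%:R <= B * (ideal_norm a)%:R]].

(* I contains exactly one generator of each of these ideals, and nothing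
   else. *)
Definition is_generator_set (a : set K) (B : R) (I : set K) : Prop :=
  set_bij I (bounded_principal_ideals a B) (@principal_ideal K).

Definition A_bound (I : set K) (v : 'I_r.+1) : R :=
  set_min [set Lambda E y v 0 | y in I].

Definition L_bound (a : set K) (B : R) (I : set K) (v : 'I_r.+1) : R :=
  (local_degree E v)%:R / (degree K)%:R * (ln B + ln (ideal_norm a)%:R)
  + D_bound v - A_bound I v.

(* [lift ord_max j] is the place v_j for j <= r, and [ord_max] is v_{r+1}. *)
Definition U_polytope (a : set K) (B : R) (I : set K) : set 'cV[R]_r :=
  [set t | (forall j, t j 0 <= L_bound a B I (lift ord_max j)) /\
           \sum_j t j 0 >= - L_bound a B I ord_max].

Definition T_matrix : 'M[R]_r := \matrix_(i, j) Lambda_tilde E (eps j) i 0.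

Definition g_set (a : set K) (B : R) (I : set K) : set K :=
  [set g | exists (m : 'cV[int]_r) (y : K),
     [/\ I y,
         (mulmx T_matrix @^-1` U_polytope a B I) (map_mx intr m),
         g = (\prod_j eps j ^ m j 0) * y
       & P_box a B (Phi E g)]].

End Algorithm.

Definition mu_orbit (K : fieldExtType rat) (x : K) : set K :=
  [set z * x | z in @roots_of_unity K].

(* S is a complete set of representatives for C / mu_K. *)
Definition complete_representatives (K : fieldExtType rat) (C S : set K) :=
  S `<=` C /\ set_bij S (@mu_orbit K @` C) (@mu_orbit K).

(* Main.v *)
Require Import Defs.
From HB Require Import structures.
From mathcomp Require Import all_boot all_order all_algebra all_field.
From mathcomp Require Import finmap.
From mathcomp Require Import all_classical all_reals all_analysis.
From mathcomp Require Import complex.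

Set Implicit Arguments.
Unset Strict Implicit.
Unset Printing Implicit Defensive.

Import Order.TTheory GRing.Theory Num.Theory.

Local Open Scope classical_set_scope.
Local Open Scope ring_scope.

(** A nonzero [x] of [C_set] generates a principal ideal contained in [a], whose
    index in the ring of integers is the absolute value of the norm of [x]; this
    ideal is therefore generated by exactly one [y] of [I], and [x = u * y] for a
    unit [u]. As the vectors [Lambda (eps j)] form a basis of the unit lattice,
    [u] is a unit monomial in the [eps j] times an element of the kernel of
    [Lambda], and this kernel consists of roots of unity by Kronecker's theorem
    ([unit_decomposition]). So [x] lies in the orbit of some [g], and [g]
    satisfies the box condition because roots of unity have absolute value 1
    at all places. That the exponents lie in the polytope ([mem_polytope]) is a
    comparison of [Lambda x = Lambda u + Lambda y] with the box, which bounds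
    [Lambda x] from above, and with the minima [A_bound], which bound [Lambda y]
    from below; the last coordinate of [Lambda u] is minus the sum of the others
    by the product formula. Conversely an associate pair [g], [g'] has the same
    [y] and the same image under [Lambda], hence the same exponents
    ([mu_orbit_inj]).

    This rests on some algebraic number theory, which is derived from the matrix
    of the embeddings applied to a basis of [K] ([emb_mx]). It is invertible by
    a Vandermonde determinant in the conjugates of a primitive element, and it
    diagonalises the multiplication maps. Hence the norm is the product of the
    conjugates ([field_norm_prod]), a [rat]-basis of algebraic integers with
    least discriminant is an integral basis ([integral_basis_exists]), and an
    algebraic integer with bounded conjugates has bounded integral coordinates
    ([finite_bounded_integers]), which gives both Kronecker's theorem and the
    finiteness of [C_set]. In an integral basis the index of a principal ideal
    is the determinant of an integer matrix ([lattice_index]), and an ideal of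
    norm at most [N] is a union of residue classes modulo [N`!]
    ([finite_principal_ideals]), so [I] is finite and its minima are attained. *)

(** * The embeddings of a number field *)

Lemma number_field_primitive_element (K : fieldExtType rat) :
  exists theta : K, <<1; theta>>%VS = fullv.
Proof.
have K0 : [pchar K] =i pred0 by move=> p; rewrite pchar_lalg pchar_num.
exists (separable_generator 1 {:K}).
rewrite -eq_adjoin_separable_generator ?sub1v //.
by apply/separableP => y _; apply: pcharf0_separable.
Qed.

Section EmbeddingsOfRoots.
Variables (C : numClosedFieldType) (K : fieldExtType rat) (theta : K).
Hypothesis theta_gen : <<1; theta>>%VS = {:K}%VS.

Lemma rmorph_horner_rat (f : {rmorphism K -> C}) (p : {poly rat}) :
  f (map_poly (in_alg K) p).[theta] = (map_poly ratr p).[f theta].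
Proof.
rewrite -horner_map -map_poly_comp; congr _.[_].
by apply: eq_map_poly => c /=; rewrite alg_num_field fmorph_rat.
Qed.

Lemma horner_theta x : exists p : {poly rat}, x = (map_poly (in_alg K) p).[theta].
Proof. by apply/Fadjoin1_polyP; rewrite theta_gen memvf. Qed.

(** An element of [K] is the value at [theta] of a rational polynomial, unique
    up to multiples of the minimal polynomial, so its value at [z] is well
    defined. *)
Lemma embedding_of_root (q : {poly rat}) (z : C) :
  minPoly 1 theta = map_poly (in_alg K) q -> root (map_poly ratr q) z ->
  exists f : {rmorphism K -> C}, f theta = z.
Proof.
move=> minq qz0; have [h hP] := choice horner_theta.
pose f x := (map_poly ratr (h x)).[z].
have fE p : f (map_poly (in_alg K) p).[theta] = (map_poly ratr p).[z].
  apply/eqP; rewrite -subr_eq0 -hornerN -hornerD -rmorphB -rootE.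
  rewrite -dvdp_XsubCl (dvdp_trans _ (_ : map_poly ratr q %| _)) ?dvdp_XsubCl //.
  rewrite dvdp_map -(dvdp_map (in_alg K)) -minq; apply: minPoly_dvdp.
    exact: alg_polyOver.
  by rewrite rootE rmorphB hornerD hornerN -hP subrr.
have fB : zmod_morphism f.
  move=> x y; have [p ->] := horner_theta x; have [p' ->] := horner_theta y.
  by rewrite -hornerN -hornerD -rmorphB !fE rmorphB hornerD hornerN.
have fM : monoid_morphism f.
  split=> [|x y].
    by have:= fE 1; rewrite !rmorph1 !hornerC.
  have [p ->] := horner_theta x; have [p' ->] := horner_theta y.
  by rewrite -hornerM -rmorphM !fE rmorphM hornerM.
pose fR : {rmorphism K -> C} := HB.pack f
  (GRing.isZmodMorphism.Build _ _ f fB) (GRing.isMonoidMorphism.Build _ _ f fM).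
exists fR; have := fE 'X.
by rewrite !map_polyX !hornerX.
Qed.

Lemma rmorph_eq_gen (f g : {rmorphism K -> C}) : f theta = g theta -> f =1 g.
Proof.
by move=> fg x; have [p ->] := horner_theta x; rewrite !rmorph_horner_rat fg.
Qed.

(** The minimal polynomial of [theta] is separable, so it has as many roots in
    [C] as its degree, and an embedding is determined by the root to which it
    sends [theta]. *)
Lemma all_embeddings : exists sig : 'I_(\dim {:K}) -> {rmorphism K -> C},
  injective (fun i => sig i theta) /\
  forall f : {rmorphism K -> C}, exists i, f =1 sig i.
Proof.
have /polyOver1P[q minq] := minPolyOver 1 theta.
have mon_q : q \is monic by rewrite -(map_monic (in_alg K)) -minq monic_minPoly.
have [rs qE] := closed_field_poly_normal (map_poly (ratr : rat -> C) q).
rewrite (monicP _) ?map_monic // scale1r in qE.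
have sz_rs : size rs = \dim {:K}.
  apply: succn_inj; rewrite -(size_prod_XsubC rs id) -qE size_map_poly.
  rewrite -(size_map_poly (in_alg K)) -minq size_minPoly.
  by congr _.+1; have := dim_Fadjoin 1 theta; rewrite theta_gen dimv1 muln1.
have uniq_rs : uniq rs.
  rewrite -separable_prod_XsubC -qE separable_map -(separable_map (in_alg K)) -minq.
  have K0 : [pchar K] =i pred0 by move=> p; rewrite pchar_lalg pchar_num.
  exact: (pcharf0_separable 1 K0 theta).
have root_rs z : root (map_poly ratr q) z = (z \in rs).
  by rewrite qE root_prod_XsubC.
have sigP (i : 'I_(\dim {:K})) :
    exists f : {rmorphism K -> C}, f theta = nth 0 rs i.
  by apply: (embedding_of_root minq); rewrite root_rs mem_nth // sz_rs.
have [sig sigE] := choice sigP; exists sig; split=> [i j|f].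
  rewrite !sigE => /eqP; rewrite nth_uniq ?sz_rs // => /eqP.
  exact: val_inj.
have fth : f theta \in rs.
  rewrite -root_rs rootE -rmorph_horner_rat -minq minPolyxx rmorph0 eqxx //.
have lt_i : (index (f theta) rs < \dim {:K})%N by rewrite -sz_rs index_mem.
by exists (Ordinal lt_i); apply: rmorph_eq_gen; rewrite sigE /= nth_index.
Qed.

End EmbeddingsOfRoots.

(** * The matrix of the embeddings, norm and trace *)

Section EmbeddingMatrix.
Variables (C : numClosedFieldType) (K : fieldExtType rat).
Local Notation n := (\dim {:K}).
Variable sig : 'I_n -> {rmorphism K -> C}.

(** As many embeddings as the degree, told apart by one primitive element:
    hence all of them. In this form it feeds the Vandermonde determinant. *)
Definition separating_embeddings := exists2 theta : K,
  <<1; theta>>%VS = {:K}%VS & injective (fun i => sig i theta).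

Definition emb_row (x : K) : 'rV[C]_n := \row_j sig j x.

Definition emb_mx (w : 'I_n -> K) : 'M[C]_n := \matrix_i emb_row (w i).

Definition rat_comb (w : 'I_n -> K) (c : 'rV[rat]_n) : K := \sum_i c 0 i *: w i.

Hypothesis sig_sep : separating_embeddings.

Lemma rmorph_ratZ (f : {rmorphism K -> C}) a x : f (a *: x) = ratr a * f x.
Proof. by rewrite -mulr_algl alg_num_field rmorphM fmorph_rat. Qed.

Lemma emb_row_comb w c : emb_row (rat_comb w c) = map_mx ratr c *m emb_mx w.
Proof.
apply/rowP=> j; rewrite !mxE rmorph_sum; apply: eq_bigr => i _.
by rewrite !mxE /= rmorph_ratZ.
Qed.

(** Powers of [theta] turn the matrix of the embeddings into a Vandermonde
    matrix. *)
Lemma emb_mx_basis (w : 'I_n -> K) :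
  (forall x, exists c, x = rat_comb w c) -> emb_mx w \in unitmx.
Proof.
move=> span_w; have [theta _ sig_inj] := sig_sep.
have [c cE] := choice (fun k : 'I_n => span_w (theta ^+ k)).
pose V := Vandermonde n (\row_j sig j theta).
have VE : map_mx ratr (\matrix_k c k) *m emb_mx w = V.
  apply/row_matrixP => k; rewrite row_mul -map_row rowK -emb_row_comb -cE.
  by apply/rowP=> j; rewrite !mxE rmorphXn.
have : V \in unitmx.
  rewrite unitmxE det_Vandermonde unitfE.
  apply/prodf_neq0 => i _; apply/prodf_neq0 => j lt_ij.
  rewrite !mxE subr_eq0; apply: contraTneq lt_ij => /sig_inj ->.
  by rewrite ltnn.
by rewrite -VE unitmx_mul => /andP[].
Qed.

Let b (i : 'I_n) : K := (vbasis {:K})`_i.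

Lemma b_basis : basis_of {:K} (vbasis {:K}). Proof. exact: vbasisP. Qed.

Lemma rat_comb_vecof c : rat_comb b c = passmx.vecof (vbasis {:K}) c.
Proof. by []. Qed.

Lemma emb_mx_vbasis : emb_mx b \in unitmx.
Proof.
apply: emb_mx_basis => x; exists (passmx.rVof (vbasis {:K}) x).
by rewrite rat_comb_vecof passmx.rVofK // b_basis.
Qed.

Lemma emb_mx_span (w : 'I_n -> K) :
  emb_mx w \in unitmx -> forall x, exists c, x = rat_comb w c.
Proof.
pose P := \matrix_i passmx.rVof (vbasis {:K}) (w i).
have wE i : w i = rat_comb b (row i P).
  by rewrite rowK rat_comb_vecof passmx.rVofK // b_basis.
have VE : emb_mx w = map_mx ratr P *m emb_mx b.
  apply/row_matrixP => i; rewrite row_mul -map_row -emb_row_comb -wE.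
  by rewrite rowK.
rewrite VE unitmx_mul map_unitmx => /andP[uP _] x.
exists (passmx.rVof (vbasis {:K}) x *m invmx P).
rewrite -[LHS](passmx.rVofK b_basis) -rat_comb_vecof /rat_comb.
under [RHS]eq_bigr => i _ do rewrite wE /rat_comb scaler_sumr.
rewrite exchange_big /=; apply: eq_bigr => j _.
under eq_bigr => i _ do rewrite scalerA [row _ _ _ _]mxE.
rewrite -scaler_suml; congr (_ *: _).
by rewrite -[in LHS](mulmxKV uP (passmx.rVof _ x)) mxE.
Qed.

Section Basis.
Variable w : 'I_n -> K.
Hypothesis w_unit : emb_mx w \in unitmx.

Lemma rat_comb_inj : injective (rat_comb w).
Proof.
move=> c c' /(congr1 emb_row); rewrite !emb_row_comb => /(can_inj (mulmxK w_unit)).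
exact: (map_mx_inj (f := ratr)).
Qed.

(** The embeddings are common eigenvectors of all the multiplications, so that
    determinant and trace become the product and the sum of the conjugates. *)
Lemma emb_mx_diag x (M : 'M[rat]_n) :
  (forall i, x * w i = rat_comb w (row i M)) ->
  map_mx ratr M *m emb_mx w = emb_mx w *m diag_mx (emb_row x).
Proof.
move=> xw; apply/row_matrixP => i.
rewrite row_mul -map_row -emb_row_comb -xw.
by apply/rowP=> j; rewrite mul_mx_diag !mxE rmorphM mulrC.
Qed.

Lemma det_mul_mx x (M : 'M[rat]_n) :
  (forall i, x * w i = rat_comb w (row i M)) ->
  ratr (\det M) = \prod_j sig j x.
Proof.
move=> /emb_mx_diag/(congr1 determinant); rewrite !det_mulmx mulrC.
have /mulrI/[apply] : \det (emb_mx w) \is a GRing.unit by rewrite -unitmxE.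
by rewrite det_map_mx det_diag => ->; apply: eq_bigr => j _; rewrite mxE.
Qed.

Lemma trace_mul_mx x (M : 'M[rat]_n) :
  (forall i, x * w i = rat_comb w (row i M)) ->
  ratr (\tr M) = \sum_j sig j x.
Proof.
move=> /emb_mx_diag/(congr1 (fun A => invmx (emb_mx w) *m A))/(congr1 mxtrace).
rewrite mxtrace_mulC mulmxK // mulKmx //.
rewrite trace_map_mx mxtrace_diag => ->.
by apply: eq_bigr => j _; rewrite mxE.
Qed.

End Basis.

Lemma field_norm_prod x : ratr (field_norm x) = \prod_j sig j x.
Proof.
apply: (det_mul_mx emb_mx_vbasis) => i.
rewrite rat_comb_vecof rowE -(passmx.hom_vecof _ b_basis).
by rewrite passmx.vecof_delta lfunE /=.
Qed.

Lemma trace_rat x : exists q : rat, \sum_j sig j x = ratr q.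
Proof.
have [c cE] := choice (fun i => emb_mx_span emb_mx_vbasis (x * b i)).
exists (\tr (\matrix_i c i)); apply/esym.
by apply: (trace_mul_mx emb_mx_vbasis) => i; rewrite rowK.
Qed.

(** The discriminant is the determinant of the trace form. *)
Lemma disc_rat w : exists q : rat, \det (emb_mx w) ^+ 2 = ratr q.
Proof.
have [t tE] := choice (fun ij : 'I_n * 'I_n => trace_rat (w ij.1 * w ij.2)).
exists (\det (\matrix_(i, j) t (i, j))).
rewrite -det_map_mx expr2 -{2}det_tr -det_mulmx; congr (\det _).
apply/matrixP => i j; rewrite !mxE; apply: etrans (tE (i, j)); apply: eq_bigr => k _.
by rewrite !mxE rmorphM.
Qed.

End EmbeddingMatrix.

(** * Algebraic integers *)

Section Integrality.
Variable F : fieldType.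
Local Notation integral := (integralOver (intr : int -> F)).
Let iZ : {rmorphism int -> F} := intr.

Lemma integral_intr (m : int) : integral m%:~R.
Proof. exact: (integral_id (intr : {rmorphism int -> F})). Qed.

Lemma integral_exp x k : integral x -> integral (x ^+ k).
Proof.
move=> ix; elim: k => [|k IH]; first by rewrite expr0; apply: (integral1 iZ).
by rewrite exprS; apply: (integral_mul (RtoK := iZ)).
Qed.

Lemma integral_bigsum I (s : seq I) (P : pred I) (x : I -> F) :
  (forall i, integral (x i)) -> integral (\sum_(i <- s | P i) x i).
Proof.
move=> ix; apply: (big_ind integral) => //; first exact: (mxpoly.integral0 iZ).
exact: (integral_add (RtoK := iZ)).
Qed.

Lemma integral_bigprod I (s : seq I) (P : pred I) (x : I -> F) :
  (forall i, integral (x i)) -> integral (\prod_(i <- s | P i) x i).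
Proof.
move=> ix; apply: (big_ind integral) => //; first exact: (integral1 iZ).
exact: (integral_mul (RtoK := iZ)).
Qed.

Lemma integral_det n (A : 'M[F]_n) :
  (forall i j, integral (A i j)) -> integral (\det A).
Proof.
move=> iA; apply: integral_bigsum => s; apply: (integral_mul (RtoK := iZ)).
  by apply: integral_exp; apply: (integral_opp (RtoK := iZ)); apply: (integral1 iZ).
by apply: integral_bigprod.
Qed.

End Integrality.

Lemma integral_embedding (K L : fieldType) (f : {rmorphism K -> L}) (x : K) :
  integralOver (intr : int -> K) x -> integralOver (intr : int -> L) (f x).
Proof.
case=> p mon_p px0; exists p => //.
rewrite (@eq_map_poly _ _ intr (f \o intr)); last first.
  by move=> m /=; rewrite rmorph_int.
by rewrite map_poly_comp rootE horner_map (rootP px0) rmorph0.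
Qed.

(** The integers are integrally closed: by Gauss's lemma the factor [X - q] of
    a monic integral polynomial is itself integral. *)
Lemma rat_integral_int (C : numFieldType) (q : rat) :
  integralOver (intr : int -> C) (ratr q) -> exists m : int, q = m%:~R.
Proof.
case=> p mon_p pq0.
have rootq : root (map_poly (intr : int -> rat) p) q.
  rewrite -(fmorph_root (ratr : {rmorphism rat -> C})) -map_poly_comp.
  rewrite (@eq_map_poly _ _ _ intr) // => m /=; exact: ratr_int.
move: rootq; rewrite -dvdp_XsubCl => /dvdpP_rat_int[p1 [a nz_a qE]] [s pE].
have : lead_coef p1 * lead_coef s = 1.
  by rewrite -lead_coefM -pE (monicP mon_p).
have sz_p1 : size p1 = 2%N.
  by rewrite -(size_rat_int_poly p1) -(size_scale _ nz_a) -qE size_XsubC.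
move=> lead1.
have [u uE] : exists u : int, (lead_coef p1)%:~R = u%:~R^-1 :> rat.
  exists (lead_coef s); apply: (mulIf (x := (lead_coef s)%:~R)).
    by rewrite intr_eq0; apply: contra_eq_neq lead1 => ->; rewrite mulr0.
  rewrite -intrM lead1 mulVf // intr_eq0.
  by apply: contra_eq_neq lead1 => ->; rewrite mulr0.
have aE : a = u%:~R.
  have := congr1 (fun P : {poly rat} => P`_1) qE.
  rewrite coefB coefX coefC /= subr0 coefZ coef_map /=.
  have -> : p1`_1 = lead_coef p1 by rewrite lead_coefE sz_p1.
  rewrite uE => aE.
  have nz_u : u%:~R != 0 :> rat.
    apply: contra_eq_neq aE => ->; rewrite invr0 mulr0 oner_eq0 //.
  by rewrite -[a](mulfVK nz_u) -aE mul1r.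
exists (- (u * p1`_0)).
have := congr1 (fun P : {poly rat} => P`_0) qE.
rewrite coefB coefX coefC /= coefZ coef_map /= aE sub0r -intrM => /eqP.
by rewrite eqr_oppLR => /eqP ->; rewrite rmorphN.
Qed.

(** If [d] clears the denominators of the minimal polynomial [p] of [x], and
    [k] is its degree, then [d * x] is a root of the monic polynomial with
    coefficients [d ^+ (k - i) * p`_i]. *)
Lemma integral_multiple (K : fieldExtType rat) (x : K) :
  exists2 d : int, d != 0 & ring_of_integers (d%:~R * x).
Proof.
pose iZ : {rmorphism int -> K} := intr.
have /polyOver1P[p minp] := minPolyOver 1 x.
have mon_p : p \is monic by rewrite -(map_monic (in_alg K)) -minp monic_minPoly.
have [q [d nz_d pE]] := rat_poly_scale p.
exists d => //; set k := (size p).-1.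
have sz_p : size p = k.+1.
  by rewrite /k prednK // lt0n size_poly_eq0 monic_neq0.
pose r : {poly K} := \poly_(i < k.+1) (d%:~R ^+ (k - i) * (map_poly (in_alg K) p)`_i).
have rk : r`_k = 1.
  rewrite coef_poly ltnSn subnn mul1r coef_map /=.
  have -> : p`_k = 1 by rewrite -(monicP mon_p) lead_coefE.
  by rewrite scale1r.
have mon_r : r \is monic.
  rewrite monicE lead_coefE (_ : size r = k.+1) ?rk //.
  by apply: size_poly_eq; have := rk; rewrite coef_poly ltnSn => ->; rewrite oner_eq0.
apply: (integral_root_monic (RtoK := iZ) mon_r).
  rewrite rootE /r horner_poly.
  have -> : \sum_(i < k.+1) d%:~R ^+ (k - i) * (map_poly (in_alg K) p)`_i *
      (d%:~R * x) ^+ i = d%:~R ^+ k * (map_poly (in_alg K) p).[x].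
    rewrite horner_coef size_map_poly sz_p mulr_sumr; apply: eq_bigr => i _.
    by rewrite exprMn mulrACA -exprD subnK // -ltnS.
  by rewrite -minp minPolyxx mulr0.
apply/integral_poly => i; rewrite coef_poly.
case: ifP => lt_ik; last exact: (mxpoly.integral0 iZ).
move: lt_ik; rewrite ltnS leq_eqVlt => /predU1P[->|lt_ik].
  rewrite subnn mul1r coef_map /=.
  have -> : p`_k = 1 by rewrite -(monicP mon_p) lead_coefE.
  by rewrite scale1r; apply: (integral1 iZ).
rewrite -(subnSK lt_ik) exprSr -mulrA; apply: (integral_mul (RtoK := iZ)).
  by apply: integral_exp; apply: integral_intr.
rewrite pE coef_map coefZ coef_map /=.
rewrite -[d%:~R in X in X * _](rmorph_int (in_alg K)) -rmorphM mulrA mulfV ?intr_eq0 //.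
by rewrite mul1r rmorph_int; apply: integral_intr.
Qed.

(** * Integral bases *)

(** Cramer's rule, in the form that tracks the discriminant when one basis vector
    is exchanged. *)
Lemma det_replace_row (R : comNzRingType) n (A A' : 'M[R]_n) i (c : 'rV[R]_n) :
  row i A' = c *m A -> (forall j, j != i -> row j A' = row j A) ->
  \det A' = c 0 i * \det A.
Proof.
move=> rowi rowN; rewrite (expand_det_row _ i).
have cofE j : cofactor A' i j = cofactor A i j.
  rewrite /cofactor; congr (_ * \det _); apply/matrixP => k l; rewrite !mxE.
  have /rowP/(_ (lift j l)) : row (lift i k) A' = row (lift i k) A.
    by apply: rowN; rewrite eq_sym neq_lift.
  by rewrite !mxE.
transitivity ((c *m A *m \adj A) 0 i).
  rewrite mxE; apply: eq_bigr => j _.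
  by rewrite cofE -rowi !mxE.
by rewrite -mulmxA mul_mx_adj mul_mx_scalar !mxE mulrC.
Qed.

Section IntegralBasis.
Variables (C : numClosedFieldType) (K : fieldExtType rat).
Local Notation n := (\dim {:K}).
Variable sig : 'I_n -> {rmorphism K -> C}.
Hypothesis sig_sep : separating_embeddings sig.

Lemma integral_family :
  exists2 w : 'I_n -> K, (forall i, ring_of_integers (w i)) & emb_mx sig w \in unitmx.
Proof.
have [d dP] := choice (fun i : 'I_n =>
  let: ex_intro2 d nz int_d := integral_multiple (vbasis {:K})`_i in
  ex_intro (fun d : int => _ /\ _) d (conj nz int_d)).
exists (fun i => (d i)%:~R * (vbasis {:K})`_i) => [i|]; first by have [] := dP i.
apply: emb_mx_basis => // x.
have [c ->] := emb_mx_span (emb_mx_vbasis sig_sep) x.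
exists (\row_i (c 0 i / (d i)%:~R)); apply: eq_bigr => i _.
rewrite mxE -(rmorph_int (in_alg K)) mulr_algl scalerA mulfVK // intr_eq0.
by have [] := dP i.
Qed.

Lemma disc_nat w : (forall i, ring_of_integers (w i)) ->
  exists m : nat, `|\det (emb_mx sig w) ^+ 2| = m%:R.
Proof.
move=> int_w; have [q qE] := disc_rat sig_sep w.
have [|m mE] := @rat_integral_int C q.
  rewrite -qE; apply: integral_exp; apply: integral_det => i j.
  by rewrite !mxE; apply: integral_embedding; apply: int_w.
exists `|m|%N; rewrite qE mE ratr_int -intr_norm.
by rewrite pmulrn abszE.
Qed.

Definition integral_basis (w : 'I_n -> K) := [/\ forall i, ring_of_integers (w i),
  emb_mx sig w \in unitmx & forall x, ring_of_integers x ->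
  exists c : 'rV[int]_n, x = rat_comb w (map_mx intr c)].

(** Among the integral [rat]-bases, one of least discriminant is an integral
    basis: if some coordinate of an algebraic integer [x] were not an integer,
    then exchanging a basis vector for [x], reduced so that this coordinate
    lies strictly between 0 and 1, would make the discriminant smaller. *)
Lemma integral_basis_exists : exists w, integral_basis w.
Proof.
pose P (m : nat) := exists w : 'I_n -> K, [/\ forall i, ring_of_integers (w i),
  emb_mx sig w \in unitmx & `|\det (emb_mx sig w) ^+ 2| = m%:R].
have exP : exists m, `[< P m >].
  have [w int_w unit_w] := integral_family; have [m mE] := disc_nat int_w.
  by exists m; apply/asboolP; exists w.
case: (ex_minnP exP) => m /asboolP[w [int_w unit_w mE]] min_m.
exists w; split=> // x int_x.
have [c xE] := emb_mx_span unit_w x.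
have [int_c|] := pselect (forall i, c 0 i \is a Num.int).
  exists (\row_i Num.floor (c 0 i)); rewrite xE; congr rat_comb.
  by apply/rowP => i; rewrite !mxE floorK.
move=> /existsNP[i /negP not_int]; exfalso.
pose f := c 0 i - (Num.floor (c 0 i))%:~R.
have f_gt0 : 0 < f.
  rewrite subr_gt0 lt_neqAle floor_le andbT.
  by apply: contraNneq not_int => <-; apply: intr_int.
have f_lt1 : f < 1 by rewrite ltrBlDl; have := floorD1_gt (c 0 i); rewrite intrD.
pose x' := x - (Num.floor (c 0 i))%:~R * w i.
pose c' := \row_j (if j == i then f else c 0 j).
have x'E : x' = rat_comb w c'.
  rewrite /x' xE /rat_comb (bigD1 i) //= [RHS](bigD1 i) //= addrAC !mxE eqxx.
  congr (_ + _); last by apply: eq_bigr => j /negPf nij; rewrite mxE nij.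
  by rewrite -(rmorph_int (in_alg K)) mulr_algl -scalerBl.
pose w' j := if j == i then x' else w j.
have int_w' : forall j, ring_of_integers (w' j).
  move=> j; rewrite /w'; case: ifP => // _; pose iZ : {rmorphism int -> K} := intr.
  apply: (integral_sub (RtoK := iZ)) => //; apply: (integral_mul (RtoK := iZ)).
    exact: integral_intr.
  exact: int_w.
have detE : \det (emb_mx sig w') = ratr f * \det (emb_mx sig w).
  have -> : ratr f = (map_mx ratr c') 0 i :> C by rewrite !mxE eqxx.
  apply: det_replace_row => [|k nki]; rewrite !rowK /w'.
    by rewrite eqxx x'E emb_row_comb.
  by rewrite (negPf nki).
have unit_w' : emb_mx sig w' \in unitmx.
  rewrite unitmxE detE unitrM -unitmxE unit_w andbT unitfE.
  by rewrite fmorph_eq0 gt_eqF.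
have [m' m'E] := disc_nat int_w'.
have /min_m : `[< P m' >] by apply/asboolP; exists w'.
rewrite leqNgt -(ltr_nat C) -mE -m'E detE exprMn normrM.
rewrite gtr_pMl ?normr_gt0 ?expf_neq0 -?unitfE -?unitmxE //.
rewrite -rmorphXn -ratr_norm /=.
rewrite -[X in _ < X](rmorph1 (ratr : {rmorphism rat -> C})) ltr_rat.
by rewrite ger0_norm ?exprn_ge0 ?exprn_ilt1 ?ltW.
Qed.

End IntegralBasis.

(** * The index of a lattice *)

Lemma absz_unit (m : int) : m \is a GRing.unit -> `|m|%N = 1%N.
Proof. by case/orP => /eqP ->. Qed.

(** The Smith normal form reduces the count to a diagonal matrix, for which the
    remainders modulo the diagonal entries are representatives. *)
Lemma lattice_index n (A : 'M[int]_n) : \det A != 0 ->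
  exists (T : finType) (rep : T -> 'rV[int]_n),
  [/\ #|T| = `|\det A|%N,
      forall t t' c, rep t - rep t' = c *m A -> t = t'
    & forall u, exists t c, u - rep t = c *m A].
Proof.
have [L uL [R uR [d _ ->]]] := int_Smith_normal_form A.
set D := \matrix_(i, j) _.
have DE : D = diag_mx (\row_i d`_i).
  by apply/matrixP => i j; rewrite !mxE.
have detD : \det D = \prod_i d`_(i : 'I_n).
  by rewrite DE det_diag; apply: eq_bigr => i _; rewrite mxE.
rewrite !det_mulmx detD => nz_det.
have nz_d (i : 'I_n) : d`_i != 0.
  by apply: contraNneq nz_det => di0; rewrite (bigD1 i) //= di0 !(mul0r, mulr0).
pose T := {dffun forall i : 'I_n, 'I_(`|d`_i|)}.
pose q (t : T) : 'rV[int]_n := \row_i (t i : nat)%:Z.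
exists T, (fun t => q t *m R); split=> [|t t' c|u].
- rewrite card_dep_ffun !abszM (absz_unit (m := \det L)) -?unitmxE //.
  rewrite (absz_unit (m := \det R)) -?unitmxE // mul1n muln1.
  rewrite (big_morph absz abszM absz1).
  by rewrite foldrE big_map big_enum /=; apply: eq_bigr => i _; rewrite card_ord.
- rewrite -mulmxBl !mulmxA => /(can_inj (mulmxK uR)) /rowP tE.
  apply/ffunP => i; apply: val_inj => /=.
  have := tE i; rewrite DE mul_mx_diag !mxE => /eqP; rewrite subr_eq => /eqP.
  move=> /(congr1 (fun m => m %% d`_i)%Z); rewrite modzMDl.
  have lt_abs (s : T) : (s i : nat)%:Z < `|d`_i| by rewrite -abszE ltz_nat ltn_ord.
  by rewrite -!(modz_abs _ d`_i) !modz_small ?lt_abs //= => -[].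
- have [v ->] : exists v, u = v *m R.
    by exists (u *m invmx R); rewrite mulmxKV.
  have lt_mod (i : 'I_n) : (`|(v 0%R i %% (d`_i)%R)%Z| < `|(d`_i)%R|)%N.
    by rewrite -ltz_nat !abszE ger0_norm ?modz_ge0 // ltz_mod.
  exists [ffun i => Ordinal (lt_mod i)].
  exists ((\row_i (v 0%R i %/ (d`_i)%R)%Z) *m invmx L).
  rewrite !mulmxA mulmxKV // -mulmxBl; congr (_ *m R).
  apply/rowP => i; rewrite DE mul_mx_diag !mxE ffunE /= abszE ger0_norm ?modz_ge0 //.
  apply/eqP; rewrite subr_eq. by apply/eqP/divz_eq.
Qed.

Lemma fset_set_range (T : finType) (U : choiceType) (f : T -> U) :
  injective f -> #|` fset_set (range f)| = #|T|.
Proof.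
move=> inj_f; have -> : range f = [set` [fset f t | t in T]%fset].
  apply/seteqP; split=> u /=.
    by case=> t _ <-; apply/imfsetP; exists t.
  by case/imfsetP => t _ ->; exists t.
by rewrite set_fsetK card_imfset //= -cardE.
Qed.

(** * Principal ideals and norms of units *)

Section IdealsAndUnits.
Variables (C : numClosedFieldType) (K : fieldExtType rat).
Local Notation n := (\dim {:K}).
Local Notation iZ := (intr : {rmorphism int -> K}).
Variables (sig : 'I_n -> {rmorphism K -> C}) (w : 'I_n -> K).
Hypothesis sig_sep : separating_embeddings sig.
Hypothesis w_basis : integral_basis sig w.

Definition int_comb (c : 'rV[int]_n) : K := rat_comb w (map_mx intr c).

Lemma int_combE c : int_comb c = \sum_i (c 0 i)%:~R * w i.
Proof.
apply: eq_bigr => i _; rewrite mxE -mulr_algl.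
by rewrite -[in RHS](rmorph_int (in_alg K)).
Qed.

Lemma int_combD c c' : int_comb (c + c') = int_comb c + int_comb c'.
Proof.
rewrite !int_combE -big_split; apply: eq_bigr => i _ /=.
by rewrite mxE intrD mulrDl.
Qed.

Lemma int_combZ a c : int_comb (a *: c) = a%:~R * int_comb c.
Proof.
by rewrite !int_combE mulr_sumr; apply: eq_bigr => i _; rewrite mxE intrM mulrA.
Qed.

Lemma int_combB c c' : int_comb (c - c') = int_comb c - int_comb c'.
Proof. by rewrite -scaleN1r int_combD int_combZ mulN1r. Qed.

Lemma int_comb_integral c : ring_of_integers (int_comb c).
Proof.
have [int_w _ _] := w_basis; rewrite int_combE; apply: integral_bigsum => i.
by apply: (integral_mul (RtoK := iZ)); [apply: integral_intr | apply: int_w].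
Qed.

Lemma int_combP x : ring_of_integers x -> exists c, x = int_comb c.
Proof. by have [_ _] := w_basis; apply. Qed.

Lemma int_comb_inj : injective int_comb.
Proof.
have [_ unit_w _] := w_basis.
move=> c c' /(rat_comb_inj unit_w)/matrixP eq_cc'; apply/matrixP => i j.
by have := eq_cc' i j; rewrite !mxE => /intr_inj.
Qed.

Lemma mul_int_mx x : ring_of_integers x -> exists A : 'M[int]_n,
  (forall c, x * int_comb c = int_comb (c *m A)) /\ field_norm x = (\det A)%:~R.
Proof.
have [int_w unit_w _] := w_basis => int_x.
have [a aE] := choice (fun i => int_combP (integral_mul (RtoK := iZ) int_x (int_w i))).
exists (\matrix_i a i); split=> [c|].
  rewrite !int_combE mulr_sumr.
  under eq_bigr => i _ do rewrite mulrCA aE int_combE mulr_sumr.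
  rewrite exchange_big /=; apply: eq_bigr => j _.
  rewrite mxE rmorph_sum /= mulr_suml; apply: eq_bigr => i _.
  by rewrite mxE intrM mulrA.
apply: (fmorph_inj (ratr : {rmorphism rat -> C})).
rewrite /= (field_norm_prod sig_sep).
rewrite -(det_mul_mx unit_w (M := map_mx intr (\matrix_i a i))).
  by rewrite det_map_mx.
by move=> i; rewrite -map_row rowK; apply: aE.
Qed.

Lemma field_norm_neq0 (x : K) : x != 0 -> field_norm x != 0.
Proof.
move=> nz_x; rewrite -(fmorph_eq0 (ratr : {rmorphism rat -> C})) /=.
rewrite (field_norm_prod sig_sep).
by apply/prodf_neq0 => i _; rewrite fmorph_eq0.
Qed.

Lemma field_normM (x y : K) : field_norm (x * y) = field_norm x * field_norm y.
Proof.
apply: (fmorph_inj (ratr : {rmorphism rat -> C})).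
rewrite rmorphM /= !(field_norm_prod sig_sep) -big_split.
by apply: eq_bigr => i _; rewrite rmorphM.
Qed.

(** The norm is multiplicative, and takes integral values on algebraic integers
    because an integral basis computes it as the determinant of an integer
    matrix; so it maps units to units of [int]. *)
Lemma field_norm_unit (u : K) : unit_group u -> `|field_norm u| = 1.
Proof.
case=> nz_u /mul_int_mx[A [_ NA]] /mul_int_mx[A' [_ NA']].
have norm1 : field_norm (1 : K) = 1.
  apply: (fmorph_inj (ratr : {rmorphism rat -> C})).
  rewrite /= (field_norm_prod sig_sep) rmorph1 big1 // => i _; exact: rmorph1.
have := field_normM u u^-1; rewrite mulfV // norm1 NA NA' -intrM.
move/esym; rewrite -[1]/(1%:~R : rat) => /intr_inj detAA'.
by rewrite -intr_norm -abszE absz_unit //; apply/unitrPr; exists (\det A').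
Qed.

Lemma mem_principal_ideal y A : (forall c, y * int_comb c = int_comb (c *m A)) ->
  forall c, principal_ideal y (int_comb c) <-> exists c', c = c' *m A.
Proof.
move=> yA c; split=> [[x /int_combP[c' ->]]|[c' ->]].
  by rewrite mulrC yA => /int_comb_inj <-; exists c'.
by exists (int_comb c'); [exact: int_comb_integral | rewrite mulrC yA].
Qed.

Lemma principal_idealD (y z z' : K) :
  principal_ideal y z -> principal_ideal y z' -> principal_ideal y (z + z').
Proof.
move=> [x int_x <-] [x' int_x' <-]; exists (x + x'); last by rewrite mulrDl.
exact: (integral_add (RtoK := iZ)).
Qed.

Lemma principal_idealN (y z : K) : principal_ideal y z -> principal_ideal y (- z).
Proof.
move=> [x int_x <-]; exists (- x); last by rewrite mulNr.
exact: (integral_opp (RtoK := iZ)).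
Qed.

Lemma residue_class_eq (y x x' : K) :
  residue_class (principal_ideal y) x = residue_class (principal_ideal y) x' <->
  principal_ideal y (x - x').
Proof.
split=> [/(congr1 (fun S => S x))|yxx'].
  rewrite /residue_class /= subrr => <-; exists 0; last by rewrite mul0r.
  exact: (mxpoly.integral0 iZ).
apply/seteqP; split=> z; rewrite /residue_class /= => yz.
  rewrite (_ : z - x' = (z - x) + (x - x')); last by rewrite subrKA.
  exact: principal_idealD.
rewrite (_ : z - x = (z - x') - (x - x')); last by rewrite opprB subrKA.
by apply: principal_idealD => //; apply: principal_idealN.
Qed.

(** The index of [y O] in the ring of integers is computed in an integral
    basis, where multiplication by [y] is an integer matrix. *)
Lemma ideal_norm_principal (y : K) : ring_of_integers y -> y != 0 ->
  (ideal_norm (principal_ideal y))%:R = `|field_norm y|.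
Proof.
move=> int_y nz_y; have [A [yA NA]] := mul_int_mx int_y.
have yP := mem_principal_ideal yA.
have nz_A : \det A != 0 by have := field_norm_neq0 nz_y; rewrite NA intr_eq0.
have [T [rep [cardT rep_inj rep_surj]]] := lattice_index nz_A.
pose f t := residue_class (principal_ideal y) (int_comb (rep t)).
have inj_f : injective f.
  move=> t t' /residue_class_eq; rewrite -int_combB => /yP[c]; exact: rep_inj.
have -> : ideal_norm (principal_ideal y) = #|T|.
  rewrite -(fset_set_range inj_f) /ideal_norm; congr #|` fset_set _|.
  apply/seteqP; split=> S /=.
    case=> _ /int_combP[u ->] <-; have [t [c uE]] := rep_surj u.
    exists t => //; apply/esym/residue_class_eq; rewrite -int_combB.
    by apply/yP; exists c.
  by case=> t _ <-; exists (int_comb (rep t)) => //; apply: int_comb_integral.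
by rewrite cardT NA -intr_norm pmulrn abszE.
Qed.

(** An element [y] of norm at most [N] divides [N`!], so the ideal [y O] is a
    union of residue classes modulo [N`!]. *)
Lemma finite_principal_ideals (N : nat) : finite_set
  [set J | exists y : K, [/\ ring_of_integers y, y != 0, `|field_norm y| <= N%:R
                           & J = principal_ideal y]].
Proof.
pose M := N`!; have M_gt0 : (0 < M)%N by rewrite fact_gt0.
pose T := {ffun 'I_n -> 'I_M}.
pose rep (t : T) := int_comb (\row_i (t i : nat)%:Z).
pose g (S : {set T}) := [set z : K | exists2 t, t \in S &
  exists2 x, ring_of_integers x & z = rep t + M%:R * x].
apply: (@sub_finite_set _ _ (range g)); last first.
  by apply: finite_image; apply: finite_finset.
move=> J [y [int_y nz_y leN ->]].
have [A [yA NA]] := mul_int_mx int_y; have yP := mem_principal_ideal yA.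
have M_in x : ring_of_integers x -> principal_ideal y (M%:R * x).
  move=> /int_combP[c ->].
  (* [\det A] annihilates the cokernel of [A], by the adjugate matrix *)
  have /dvdnP[k ME] : (`|\det A| %| M)%N.
    rewrite dvdn_fact // absz_gt0 -(intr_eq0 rat) -NA field_norm_neq0 //=.
    by rewrite -(ler_nat rat) (pmulrn _ `|_|) abszE intr_norm -NA.
  rewrite ME pmulrn -int_combZ PoszM abszE.
  apply/yP; exists ((k%:Z * Num.sg (\det A)) *: (c *m \adj A)).
  rewrite -scalemxAl -mulmxA mul_adj_mx mul_mx_scalar scalerA.
  by rewrite -mulrA -normrEsg.
exists (finset (fun t => `[< principal_ideal y (rep t) >])) => //.
apply/seteqP; split=> z /=.
  move=> [t]; rewrite finset.in_set => /asboolP yt [x int_x ->].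
  by apply: principal_idealD => //; apply: M_in.
move=> yz; have [x int_x zE] := yz.
have [c cE] : exists c, z = int_comb c.
  by apply: int_combP; rewrite -zE; apply: (integral_mul (RtoK := iZ)).
have lt_mod i : (`|(c 0%R i %% M)%Z| < M)%N.
  by rewrite -ltz_nat abszE ger0_norm ?modz_ge0 ?ltz_pmod // -lt0n.
pose t : T := [ffun i => Ordinal (lt_mod i)].
pose x' := int_comb (\row_i (c 0%R i %/ M)%Z).
have zE' : z = rep t + M%:R * x'.
  rewrite pmulrn -int_combZ -int_combD cE; congr int_comb.
  apply/rowP => i; rewrite !mxE ffunE /= abszE ger0_norm ?modz_ge0 -?lt0n //.
  by rewrite mulrC addrC -divz_eq.
have int_x' : ring_of_integers x' by exact: int_comb_integral.
exists t; last by exists x'.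
rewrite finset.in_set; apply/asboolP.
have -> : rep t = z - M%:R * x' by rewrite zE' addrK.
by apply: principal_idealD => //; apply: principal_idealN; apply: M_in.
Qed.

End IdealsAndUnits.

(** * Algebraic integers with bounded conjugates *)

Section Finiteness.
Variables (R : realType) (K : fieldExtType rat).
Local Notation n := (\dim {:K}).
Local Notation iZ := (intr : {rmorphism int -> K}).
Variables (sig : 'I_n -> {rmorphism K -> R[i]}) (w : 'I_n -> K).
Hypothesis w_basis : integral_basis sig w.

Lemma complex_nat_bound (z : R[i]) : exists N : nat, `|z| <= N%:R.
Proof.
exists (Num.bound (ComplexField.Normc.normc z)).
have -> : `|z| = (ComplexField.Normc.normc z)%:C%C by [].
rewrite -(rmorph_nat (real_complex R)) lecR ltW // archi_boundP //.
by rewrite -lecR; apply: (normr_ge0 z).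
Qed.

(** Inverting the matrix of the embeddings bounds the integral coordinates of
    an algebraic integer in terms of its conjugates. *)
Lemma finite_bounded_integers (b : R[i]) :
  finite_set [set x | ring_of_integers x /\ forall j, `|sig j x| <= b].
Proof.
have [_ unit_w _] := w_basis.
(* the triangle inequality for the coordinate [j] of the product with the
   inverse matrix *)
pose beta j := \sum_k b * `|invmx (emb_mx sig w) k j|.
have [N leN] : exists N : nat, forall j : 'I_n, `|beta j| <= N%:R.
  have [N leN] := complex_nat_bound (\sum_j `|beta j|).
  exists N => j; apply: le_trans leN; rewrite (bigD1 j) //= [leRHS]ger0_norm.
    by rewrite lerDl sumr_ge0.
  by rewrite addr_ge0 ?sumr_ge0.
(* coordinates between [- N] and [N], shifted by [N] *)
pose T := {ffun 'I_n -> 'I_(N * 2).+1}.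
pose f (t : T) := int_comb w (\row_j ((t j : nat)%:Z - N%:Z)).
apply: (@sub_finite_set _ _ (range f)); last first.
  by apply: finite_image; apply: finite_finset.
move=> x [/(int_combP w_basis)[c xE] le_b].
have le_c j : `|c 0 j| <= N%:Z.
  rewrite -(ler_int R[i]) intr_norm (le_trans _ (leN j)) //.
  have -> : (c 0 j)%:~R = (emb_row sig x *m invmx (emb_mx sig w)) 0 j.
    by rewrite xE /int_comb emb_row_comb mulmxK // !mxE /= ratr_int.
  rewrite mxE (le_trans (ler_norm_sum _ _ _)) //.
  rewrite [leRHS]ger0_norm; last first.
    apply: sumr_ge0 => k _; apply: mulr_ge0 => //.
    exact: le_trans (normr_ge0 _) (le_b k).
  by apply: ler_sum => k _; rewrite normrM mxE ler_wpM2r.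
have c_ge0 j : 0 <= c 0 j + N%:Z.
  by have := le_c j; rewrite ler_norml -subr_ge0 opprK addrC => /andP[].
have lt_c j : (`|(c 0 j + N%:Z)%R| < (N * 2).+1)%N.
  rewrite ltnS -lez_nat abszE ger0_norm // muln2 -addnn PoszD lerD2r.
  exact: le_trans (ler_norm _) (le_c j).
exists [ffun j => Ordinal (lt_c j)] => //; rewrite xE /f; congr int_comb.
by apply/rowP => j; rewrite !mxE ffunE /= abszE ger0_norm // addrK.
Qed.

(** Kronecker: the powers of [u] all lie in one finite set. *)
Lemma kronecker u : ring_of_integers u -> u != 0 ->
  (forall j, `|sig j u| <= 1) -> roots_of_unity u.
Proof.
move=> int_u nz_u le1.
have fin := finite_bounded_integers 1.
have [inj_u|] := pselect (injective (fun k => u ^+ k)).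
  exfalso; apply: infinite_nat.
  have := finite_preimage (f := fun k => u ^+ k) (fun k l _ _ => @inj_u k l) fin.
  apply: sub_finite_set => k _; split; first exact: integral_exp.
  by move=> j; rewrite rmorphXn normrX exprn_ile1.
move=> /existsNP[k /existsNP[l /not_implyP[eq_kl /eqP ne_kl]]].
wlog lt_kl : k l eq_kl ne_kl / (k < l)%N.
  move=> IH; case: (ltngtP k l) => [|lt_lk|ekl]; first exact: IH.
    by apply: (IH l k) => //; rewrite eq_sym.
  by rewrite ekl eqxx in ne_kl.
exists (l - k)%N; first by rewrite subn_gt0.
apply: (mulIf (expf_neq0 k nz_u)).
by rewrite -exprD subnK ?mul1r // ltnW.
Qed.

End Finiteness.

(** * Archimedean places *)

Section ArchimedeanPlaces.
Variables (R : realType) (K : fieldExtType rat) (r : nat).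
Variable E : arch_embeddings K R r.
Local Notation normc := ComplexField.Normc.normc.

(** An index set for all the embeddings into [R[i]]: real ones, representatives
    of the complex pairs, and conjugates of these representatives. *)
Definition emb_index : finType :=
  ('I_(nreal E) + ('I_(ncomplex E) + 'I_(ncomplex E)))%type.

Definition emb_of (t : emb_index) : {rmorphism K -> R[i]} :=
  match t with
  | inl i => real_complex R \o real_emb i
  | inr (inl j) => complex_emb j
  | inr (inr j) => conjc \o complex_emb j
  end.

Lemma emb_of_inj t t' : emb_of t =1 emb_of t' -> t = t'.
Proof.
(* a real value fixed by conjugation would make [complex_emb j] self-conjugate *)
have real_not_complex i (j : 'I_(ncomplex E)) (f : K -> R[i]) :
    real_complex R \o real_emb (a := E) i =1 f ->
    f =1 complex_emb j \/ f =1 conjc \o complex_emb j ->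
    False.
  move=> fi fj; apply: (@complex_emb_conj _ _ _ E j j) => x /=.
  have fx := fi x; have {}fj : f x = complex_emb j x \/ f x = conjc (complex_emb j x).
    by case: fj => fj; [left | right]; exact: fj.
  have: conjc (f x) = f x by rewrite -fx /= oppr0.
  by case: fj => ->; rewrite ?conjcK.
case: t t' => [i|[j|j]] [i'|[j'|j']] /= ett'.
- by congr inl; apply: real_emb_inj => x; have /= [] := ett' x.
- by case: (real_not_complex i j' _ ett'); left.
- by case: (real_not_complex i j' _ ett'); right.
- by case: (real_not_complex i' j _ (fsym ett')); left.
- by congr (inr (inl _)); apply: complex_emb_inj => x; exact: ett'.
- by case: (@complex_emb_conj _ _ _ E j j') => x; exact: ett'.
- by case: (real_not_complex i' j _ (fsym ett')); right.
- by case: (@complex_emb_conj _ _ _ E j' j) => x; rewrite -ett'.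
- congr (inr (inr _)); apply: complex_emb_inj => x.
  by have /= /(congr1 conjc) := ett' x; rewrite !conjcK.
Qed.

(** A self-conjugate embedding takes real values, so it comes from a real
    embedding; the others are listed by hypothesis. *)
Lemma emb_of_surj (f : {rmorphism K -> R[i]}) : exists t, f =1 emb_of t.
Proof.
have [f_real|not_real] := pselect (f =1 conjc \o f); last first.
  have [j [fj|fj]] := complex_emb_all E not_real.
    by exists (inr (inl j)).
  by exists (inr (inr j)).
have imf x : f x = (complex.Re (f x))%:C%C.
  have /= := f_real x; case: (f x) => a b /= /(congr1 (@complex.Im R)) /= /eqP.
    by rewrite -addr_eq0 -mulr2n mulrn_eq0 => /eqP ->.
pose g x := complex.Re (f x).
have gC x : (g x)%:C%C = f x by rewrite -imf.
have gB : zmod_morphism g.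
  by move=> x y; rewrite /g rmorphB; case: (f x) (f y) => ? ? [].
have gM : monoid_morphism g.
  split=> [|x y]; first by rewrite /g rmorph1.
  by apply: complexI; rewrite rmorphM /= !gC rmorphM.
pose gR : {rmorphism K -> R} := HB.pack g
  (GRing.isZmodMorphism.Build _ _ g gB) (GRing.isMonoidMorphism.Build _ _ g gM).
have [i gi] := real_emb_all E gR.
by exists (inl i) => x /=; rewrite -gi /= gC.
Qed.

(** [completion_abs] composed with [embedding], free of the dependent type of
    the completions. *)
Definition abs_at (p : 'I_(nreal E) + 'I_(ncomplex E)) (x : K) : R :=
  match p with inl i => `|real_emb i x| | inr j => normc (complex_emb j x) end.

Definition abs_place (v : 'I_r.+1) (x : K) : R := abs_at (place_split E v) x.

Lemma completion_absE v x : completion_abs (embedding E v x) = abs_place v x.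
Proof.
by rewrite /completion_abs /embedding /abs_place /completion; case: (place_split E v).
Qed.

End ArchimedeanPlaces.

Section PlacesTheory.
Variables (R : realType) (K : fieldExtType rat) (r : nat).
Variable E : arch_embeddings K R r.
Local Notation n := (\dim {:K}).

Lemma norm_real_complex (x : R) : `|x%:C%C| = `|x|%:C%C.
Proof. by rewrite normc_def /= expr0n addr0 sqrtr_sqr. Qed.

Lemma abs_place_ge0 v x : 0 <= abs_place E v x.
Proof.
rewrite /abs_place /abs_at; case: place_split => i //.
by rewrite -lecR; apply: (normr_ge0 (complex_emb i x)).
Qed.

Lemma abs_placeM v x y : abs_place E v (x * y) = abs_place E v x * abs_place E v y.
Proof.
rewrite /abs_place /abs_at; case: place_split => i.
  by rewrite rmorphM normrM.
by rewrite rmorphM ComplexField.Normc.normcM.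
Qed.

Lemma abs_place1 v : abs_place E v 1 = 1.
Proof.
rewrite /abs_place /abs_at; case: place_split => i.
  by rewrite rmorph1 normr1.
by rewrite rmorph1 ComplexField.Normc.normc1.
Qed.

Lemma abs_place_gt0 v x : x != 0 -> 0 < abs_place E v x.
Proof.
move=> nz_x; rewrite lt0r abs_place_ge0 andbT.
apply: contra_eq_neq (abs_place1 v) => x0.
by rewrite -(mulfV nz_x) abs_placeM x0 mul0r eq_sym oner_eq0.
Qed.

Lemma abs_place0 v : abs_place E v 0 = 0.
Proof.
rewrite /abs_place /abs_at; case: place_split => i.
  by rewrite rmorph0 normr0.
by rewrite rmorph0 ComplexField.Normc.normc0.
Qed.

Lemma abs_placeX v x k : abs_place E v (x ^+ k) = abs_place E v x ^+ k.
Proof.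
by elim: k => [|k IH]; rewrite ?expr0 ?abs_place1 // !exprS abs_placeM IH.
Qed.

Lemma abs_place_root_of_unity v z : roots_of_unity z -> abs_place E v z = 1.
Proof.
case=> m m_gt0 zm1; apply/eqP; rewrite -(pexpr_eq1 m_gt0) ?abs_place_ge0 //.
by rewrite -abs_placeX zm1 abs_place1.
Qed.

Lemma place_normE v x : place_norm E v x = abs_place E v x ^+ local_degree E v.
Proof. by rewrite /place_norm completion_absE. Qed.

Lemma place_norm_gt0 v x : x != 0 -> 0 < place_norm E v x.
Proof. by move=> nz_x; rewrite place_normE exprn_gt0 ?abs_place_gt0. Qed.

Lemma local_degree_gt0 v : (0 < local_degree E v)%N.
Proof. by rewrite /local_degree; case: place_split. Qed.

Lemma LambdaM x y : x != 0 -> y != 0 -> Lambda E (x * y) = Lambda E x + Lambda E y.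
Proof.
move=> nz_x nz_y; apply/colP => v; rewrite !mxE !place_normE abs_placeM exprMn.
by rewrite lnM ?posrE ?exprn_gt0 ?abs_place_gt0.
Qed.

Lemma Lambda_root_of_unity z : roots_of_unity z -> Lambda E z = 0.
Proof.
move=> root_z; apply/colP => v.
by rewrite !mxE place_normE abs_place_root_of_unity // expr1n ln1.
Qed.

Lemma Lambda1 : Lambda E 1 = 0.
Proof. by apply/colP => v; rewrite !mxE place_normE abs_place1 expr1n ln1. Qed.

Lemma LambdaV x : x != 0 -> Lambda E x^-1 = - Lambda E x.
Proof.
move=> nz_x; apply/eqP; rewrite -addr_eq0 -LambdaM ?invr_eq0 // mulVf //.
by rewrite Lambda1.
Qed.

Lemma LambdaXn x k : x != 0 -> Lambda E (x ^+ k) = Lambda E x *+ k.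
Proof.
move=> nz_x; elim: k => [|k IH]; first by rewrite expr0 Lambda1.
by rewrite exprS LambdaM ?expf_neq0 // IH mulrS.
Qed.

Lemma LambdaXz x (m : int) : x != 0 -> Lambda E (x ^ m) = Lambda E x *~ m.
Proof.
move=> nz_x; case: m => k; first exact: LambdaXn.
by rewrite NegzE -exprnN LambdaV ?expf_neq0 // LambdaXn.
Qed.

Lemma Lambda_prod (I : finType) (x : I -> K) (m : I -> int) :
  (forall i, x i != 0) -> Lambda E (\prod_i x i ^ m i) = \sum_i Lambda E (x i) *~ m i.
Proof.
move=> nz_x; pose P (y : K) S := Lambda E y = S /\ y != 0.
suff [] : P (\prod_i x i ^ m i) (\sum_i Lambda E (x i) *~ m i) by [].
apply: (big_rec2 P) => [|i y S _ [<- nz_y]]; first by rewrite /P Lambda1 oner_eq0.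
have nz_xm : x i ^ m i != 0 by apply: expfz_neq0.
by split; [rewrite LambdaM // (LambdaXz _ (nz_x i)) | exact: mulf_neq0].
Qed.

Section Complete.
Variable sig : 'I_n -> {rmorphism K -> R[i]}.
Hypothesis sig_sep : separating_embeddings sig.
Hypothesis sig_all : forall f : {rmorphism K -> R[i]}, exists i, f =1 sig i.

Lemma emb_bij : exists2 phi : emb_index E -> 'I_n, bijective phi &
  forall t, emb_of t =1 sig (phi t).
Proof.
have [phi phiE] := choice (fun t : emb_index E => sig_all (emb_of t)).
have [psi psiE] := choice (fun i => emb_of_surj E (sig i)).
have [theta _ sig_inj] := sig_sep.
exists phi => //; exists psi => [t|i].
  by apply: emb_of_inj => x; rewrite -psiE phiE.
by apply: sig_inj; rewrite -phiE psiE.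
Qed.

Lemma sig_place j : exists v, forall x, `|sig j x| = (abs_place E v x)%:C%C.
Proof.
have [phi [psi phiK psiK] phiE] := emb_bij.
pose place p := cast_ord (esym (nplaces E)) (unsplit p).
have placeK p : place_split E (place p) = p.
  by rewrite /place_split cast_ordKV unsplitK.
have sigE x : sig j x = emb_of (psi j) x by rewrite phiE psiK.
case: (psi j) sigE => [i|[i|i]] sigE.
- exists (place (inl i)) => x; rewrite sigE /abs_place placeK /=.
  exact: norm_real_complex.
- by exists (place (inr i)) => x; rewrite sigE /abs_place placeK.
- by exists (place (inr i)) => x; rewrite sigE /abs_place placeK /= normcJ.
Qed.

(** The product formula: a complex place stands for two conjugate embeddings,
    which is what squaring its absolute value accounts for. *)
Lemma prod_place_norm x : (\prod_v place_norm E v x)%:C%C = `|ratr (field_norm x)|.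
Proof.
have [phi phi_bij phiE] := emb_bij.
rewrite (field_norm_prod sig_sep) normr_prod (reindex phi) /=; last exact: onW_bij.
pose place p := cast_ord (esym (nplaces E)) (unsplit p).
have placeK : cancel place (place_split E).
  by move=> p; rewrite /place_split cast_ordKV unsplitK.
have place_bij : bijective place.
  by exists (place_split E) => // v; rewrite /place /place_split splitK cast_ordK.
rewrite rmorph_prod (reindex place) /=; last exact: onW_bij.
rewrite !big_sumType /=; congr (_ * _).
  apply: eq_bigr => i _; rewrite -phiE /= place_normE /abs_place /local_degree placeK.
  by rewrite expr1 norm_real_complex.
rewrite -big_split; apply: eq_bigr => j _ /=.
rewrite -!phiE /= normcJ place_normE /abs_place /local_degree placeK /=.
by rewrite rmorphXn expr2.
Qed.

End Complete.

End PlacesTheory.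

(** * Units, associates and roots of unity *)

Section UnitGroup.
Variable K : fieldExtType rat.
Local Notation iZ := (intr : {rmorphism int -> K}).

Lemma unit_group1 : unit_group (1 : K).
Proof.
by split; rewrite ?oner_eq0 ?invr1 //; apply: (integral1 iZ).
Qed.

Lemma unit_groupV (u : K) : unit_group u -> unit_group u^-1.
Proof. by case=> nz_u int_u int_V; split; rewrite ?invr_eq0 ?invrK. Qed.

Lemma unit_groupM (u u' : K) : unit_group u -> unit_group u' -> unit_group (u * u').
Proof.
move=> [nz_u int_u int_V] [nz_u' int_u' int_V']; split.
- by rewrite mulf_neq0.
- exact: (integral_mul (RtoK := iZ)).
- by rewrite invfM; apply: (integral_mul (RtoK := iZ)).
Qed.

Lemma unit_groupXz (u : K) (m : int) : unit_group u -> unit_group (u ^ m).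
Proof.
move=> unit_u; have unit_X k : unit_group (u ^+ k).
  elim: k => [|k IH]; first exact: unit_group1.
  by rewrite exprS; apply: unit_groupM.
by case: m => k; [exact: unit_X | rewrite NegzE -exprnN; exact/unit_groupV/unit_X].
Qed.

Lemma unit_group_prod (I : finType) (u : I -> K) (m : I -> int) :
  (forall i, unit_group (u i)) -> unit_group (\prod_i u i ^ m i).
Proof.
move=> unit_u; apply: (big_ind (@unit_group K)) => [||i _].
- exact: unit_group1.
- exact: unit_groupM.
- exact: unit_groupXz.
Qed.

Lemma roots_of_unity_unit (z : K) : roots_of_unity z -> unit_group z.
Proof.
case=> m m_gt0 zm1.
have int_root (x : K) : x ^+ m = 1 -> ring_of_integers x.
  move=> xm1; exists ('X^m - 1); first exact: monicXnsubC.
  by rewrite rmorphB /= map_polyXn rmorph1 rootE !hornerE xm1 subrr.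
split; last by apply: int_root; rewrite exprVn zm1 invr1.
  by apply: contra_eq_neq zm1 => ->; rewrite expr0n gtn_eqF // eq_sym oner_eq0.
exact: int_root.
Qed.

Lemma roots_of_unityV (z : K) : roots_of_unity z -> roots_of_unity z^-1.
Proof. by case=> m m_gt0 zm1; exists m => //; rewrite exprVn zm1 invr1. Qed.

Lemma principal_ideal_unit (x y : K) : y != 0 ->
  principal_ideal x = principal_ideal y -> exists2 u, unit_group u & x = u * y.
Proof.
move=> nz_y xy.
have id_mem (z : K) : principal_ideal z z.
  by exists 1; [apply: (integral1 iZ) | rewrite mul1r].
have [u int_u ux] : principal_ideal y x by rewrite -xy.
have [v int_v vy] : principal_ideal x y by rewrite xy.
have vu1 : v * u = 1 by apply: (mulIf nz_y); rewrite -mulrA ux vy mul1r.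
have nz_u : u != 0.
  by apply: contra_eq_neq vu1 => ->; rewrite mulr0 eq_sym oner_eq0.
by exists u => //; split=> //; rewrite -[u^-1]mul1r -vu1 mulfK.
Qed.

Lemma unit_principal_ideal (u y : K) : unit_group u ->
  principal_ideal (u * y) = principal_ideal y.
Proof.
case=> nz_u int_u int_V; apply/seteqP; split=> _ [x int_x <-].
  by exists (x * u); [apply: (integral_mul (RtoK := iZ)) | rewrite mulrA].
exists (x * u^-1); first exact: (integral_mul (RtoK := iZ)).
by rewrite mulrA mulfVK.
Qed.

End UnitGroup.

Lemma roots_of_unityM (K : fieldExtType rat) (z z' : K) :
  roots_of_unity z -> roots_of_unity z' -> roots_of_unity (z * z').
Proof.
move=> [m m_gt0 zm1] [m' m'_gt0 zm1']; exists (m * m')%N; first by rewrite muln_gt0 m_gt0.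
by rewrite exprMn exprM zm1 expr1n mulnC exprM zm1' expr1n mulr1.
Qed.

Lemma mu_orbitM (K : fieldExtType rat) (z x : K) :
  roots_of_unity z -> mu_orbit (z * x) = mu_orbit x.
Proof.
move=> root_z; have [nz_z _ _] := roots_of_unity_unit root_z.
apply/seteqP; split=> _ [t root_t <-].
  by exists (t * z); [exact: roots_of_unityM | rewrite mulrA].
exists (t * z^-1); last by rewrite mulrA mulfVK.
by apply: roots_of_unityM => //; exact: roots_of_unityV.
Qed.

Lemma mu_orbit_eq (K : fieldExtType rat) (x x' : K) :
  mu_orbit x = mu_orbit x' -> exists2 z, roots_of_unity z & x = z * x'.
Proof.
move=> xx'; have [] : mu_orbit x' x.
  by rewrite -xx'; exists 1; [exists 1%N; rewrite ?expr1n | rewrite mul1r].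
by move=> z root_z <-; exists z.
Qed.

(** * Bounds at the archimedean places *)

Lemma field_norm0 (K : fieldExtType rat) : field_norm (0 : K) = 0.
Proof.
have det0_gt0 m : (0 < m)%N -> \det (0 : 'M[rat]_m) = 0 by case: m => // m _; exact: det0.
rewrite /field_norm.
have -> : amull (0 : K) = 0 by rewrite linear0.
have -> : passmx.mxof (vbasis {:K}) (vbasis {:K}) 0 = 0.
  by apply/eqP; rewrite passmx.mxof_eq0 ?vbasisP.
by apply: det0_gt0; exact: adim_gt0.
Qed.

Lemma logarithmic_bound (R : realType) (K : fieldExtType rat) (r : nat)
    (E : arch_embeddings K R r) (eps : 'I_r -> K) (a : set K) (B : R) (x : K) v :
  0 < B -> (0 < ideal_norm a)%N -> x != 0 -> P_box eps a B (Phi E x) ->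
  Lambda E x v 0 <= (local_degree E v)%:R / (degree K)%:R *
    (ln B + ln (ideal_norm a)%:R) + D_bound E eps v.
Proof.
move=> B_gt0 N_gt0 nz_x /(_ v); rewrite completion_absE => le_x.
have d_gt0 := local_degree_gt0 E v.
have x_gt0 := abs_place_gt0 E v nz_x.
rewrite mxE place_normE lnXn //.
have NR_gt0 : 0 < (ideal_norm a)%:R :> R by rewrite ltr0n.
move: le_x; rewrite -ler_ln ?posrE ?mulr_gt0 ?powR_gt0 ?expR_gt0 ?mulr_gt0 //.
rewrite lnM ?posrE ?powR_gt0 ?expR_gt0 ?mulr_gt0 // ln_powR expRK lnM ?posrE //.
rewrite -(ler_pMn2r d_gt0) => /le_trans; apply.
rewrite mulrnDl -[X in _ + X]mulr_natr mulfVK ?pnatr_eq0 -?lt0n //.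
by rewrite -mulrnAl -[X in X * _]mulr_natl.
Qed.

Section UnitsAndPlaces.
Variables (R : realType) (K : fieldExtType rat) (r : nat).
Variable E : arch_embeddings K R r.
Local Notation n := (\dim {:K}).

Lemma exists_integral_basis : exists (sig : 'I_n -> {rmorphism K -> R[i]}) w,
  [/\ separating_embeddings sig, integral_basis sig w &
      forall f : {rmorphism K -> R[i]}, exists i, f =1 sig i].
Proof.
have [theta theta_gen] := number_field_primitive_element K.
have [sig [sig_inj sig_all]] := all_embeddings R[i] theta_gen.
have sig_sep : separating_embeddings sig by exists theta.
have [w w_basis] := integral_basis_exists sig_sep.
by exists sig, w.
Qed.

Lemma sum_Lambda_unit u : unit_group u -> \sum_v Lambda E u v 0 = 0.
Proof.
move=> unit_u; have [sig [w [sig_sep w_basis sig_all]]] := exists_integral_basis.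
have [nz_u _ _] := unit_u.
have prod1 : \prod_v place_norm E v u = 1.
  apply: complexI; rewrite (prod_place_norm E sig_sep sig_all).
  by rewrite -ratr_norm (field_norm_unit sig_sep w_basis unit_u) !rmorph1.
suff -> : \sum_v Lambda E u v 0 = ln (\prod_v place_norm E v u).
  by rewrite prod1 ln1.
pose P (S p : R) := S = ln p /\ 0 < p.
suff [] : P (\sum_v Lambda E u v 0) (\prod_v place_norm E v u) by [].
apply: (big_rec2 P) => [|v S p _ [-> p_gt0]]; first by rewrite /P ln1.
have u_gt0 := place_norm_gt0 E v nz_u.
by split; [rewrite mxE lnM | exact: mulr_gt0].
Qed.

Lemma Lambda_eq0_root_of_unity u : unit_group u -> Lambda E u = 0 -> roots_of_unity u.
Proof.
move=> [nz_u int_u _] Lu0.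
have [sig [w [sig_sep w_basis sig_all]]] := exists_integral_basis.
apply: (kronecker w_basis int_u nz_u) => j.
have [v ->] := sig_place E sig_sep sig_all j.
have abs1 : abs_place E v u = 1.
  have := congr1 (fun A : 'cV_r.+1 => A v 0) Lu0; rewrite !mxE => /eqP.
  rewrite ln_eq0 ?place_norm_gt0 // place_normE.
  by rewrite pexpr_eq1 ?local_degree_gt0 ?abs_place_ge0 // => /eqP.
by rewrite abs1 rmorph1.
Qed.

Lemma finite_box (beta : 'I_r.+1 -> R) :
  finite_set [set x : K | ring_of_integers x /\ forall v, abs_place E v x <= beta v].
Proof.
have [sig [w [sig_sep w_basis sig_all]]] := exists_integral_basis.
apply: sub_finite_set (finite_bounded_integers w_basis (\sum_v `|beta v|)%:C%C).
move=> x [int_x le_x]; split=> // j.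
have [v ->] := sig_place E sig_sep sig_all j.
rewrite lecR (le_trans (le_x v)) // (le_trans (ler_norm _)) // (bigD1 v) //=.
by rewrite lerDl sumr_ge0.
Qed.

End UnitsAndPlaces.

Lemma ideal_norm_field_norm (R : realType) (K : fieldExtType rat) (y : K) :
  ring_of_integers y -> y != 0 ->
  (ideal_norm (principal_ideal y))%:R = `|ratr (field_norm y)| :> R.
Proof.
have [sig [w [sig_sep w_basis _]]] := exists_integral_basis R K.
move=> int_y nz_y; rewrite -ratr_norm -(ideal_norm_principal sig_sep w_basis) //.
by rewrite ratr_nat.
Qed.

Lemma ratr_field_norm_unit (R : realType) (K : fieldExtType rat) (u y : K) :
  unit_group u -> `|ratr (field_norm (u * y))| = `|ratr (field_norm y)| :> R.
Proof.
have [sig [w [sig_sep w_basis _]]] := exists_integral_basis R K.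
move=> unit_u; rewrite -!ratr_norm (field_normM sig_sep) normrM.
by rewrite (field_norm_unit sig_sep w_basis unit_u) mul1r.
Qed.

Lemma finite_bounded_principal_ideals (R : realType) (K : fieldExtType rat)
  (a : set K) (B : R) : finite_set (bounded_principal_ideals a B).
Proof.
have [sig [w [sig_sep w_basis _]]] := exists_integral_basis R K.
pose M : R := B * (ideal_norm a)%:R.
apply: sub_finite_set (finite_principal_ideals sig_sep w_basis (Num.bound M)).
move=> J [y [int_y nz_y JE _ leM]]; exists y; split=> //.
rewrite -(ideal_norm_principal sig_sep w_basis) // ler_nat -(ler_nat R) -JE.
rewrite (le_trans leM) // ltW // archi_boundP //.
by rewrite (le_trans _ leM).
Qed.

Lemma field_norm_gt0 (R : realType) (K : fieldExtType rat) (x : K) :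
  x != 0 -> 0 < `|ratr (field_norm x)| :> R.
Proof.
have [sig [w [sig_sep _ _]]] := exists_integral_basis R K.
by move=> nz_x; rewrite normr_gt0 fmorph_eq0 (field_norm_neq0 sig_sep).
Qed.

Lemma finite_set_min (R : realType) (S : set R) (x : R) :
  finite_set S -> S x -> set_min S <= x.
Proof.
move=> /finite_seqP[s ->] sx.
have [m ms le_m] : exists2 m, m \in s & {in s, forall y, m <= y}.
  elim: s x sx => [|y s IH] x // _.
  case: s IH => [_|z s IH].
    by exists y; rewrite ?mem_head // => z; rewrite inE => /eqP ->.
  have [m ms le_m] := IH z (mem_head _ _).
  exists (Num.min m y); first by rewrite minElt; case: ifP; rewrite inE ?ms ?orbT ?eqxx.
  by move=> t; rewrite inE ge_min => /predU1P[->|/le_m ->] //; rewrite lexx orbT.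
have [] := @xgetPex _ 0 ([set` s] `&` lbound [set` s]).
  by exists m; split=> // y /=; exact: le_m.
by move=> _; apply.
Qed.

Lemma mulmx_T_matrix (R : realType) (K : fieldExtType rat) (r : nat)
    (E : arch_embeddings K R r) (eps : 'I_r -> K) (m : 'cV[int]_r) i :
  (T_matrix E eps *m map_mx intr m) i 0 =
  (\sum_j Lambda E (eps j) *~ m j 0) (lift ord_max i) 0.
Proof.
rewrite mxE summxE; apply: eq_bigr => j _.
by rewrite -scaler_int !mxE mulrC.
Qed.

Lemma finite_generator_set (R : realType) (K : fieldExtType rat)
    (a : set K) (B : R) (I : set K) : is_generator_set a B I -> finite_set I.
Proof.
case=> I_fun I_inj _; rewrite -(eq_finite_set (inj_card_eq I_inj)).
apply: sub_finite_set (finite_bounded_principal_ideals a B).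
by move=> _ [y Iy <-]; exact: I_fun.
Qed.

Lemma A_bound_le (R : realType) (K : fieldExtType rat) (r : nat)
    (E : arch_embeddings K R r) (I : set K) (y : K) v :
  finite_set I -> I y -> A_bound E I v <= Lambda E y v 0.
Proof.
move=> fin_I Iy; apply: finite_set_min; first exact: finite_image.
by exists y.
Qed.

(** * The representatives *)

Section Representatives.
Variables (R : realType) (K : fieldExtType rat) (r : nat).
Variables (E : arch_embeddings K R r) (a : set K) (B : R) (eps : 'I_r -> K).
Variable I : set K.
Hypothesis a_ideal : is_ideal a.
Hypothesis B_gt0 : 0 < B.
Hypothesis eps_fund : fundamental_units E eps.
Hypothesis I_gen : is_generator_set a B I.
Local Notation iZ := (intr : {rmorphism int -> K}).

Definition unit_monomial (m : 'I_r -> int) : K := \prod_j eps j ^ m j.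

Lemma unit_monomial_unit m : unit_group (unit_monomial m).
Proof. by apply: unit_group_prod => j; have [] := eps_fund. Qed.

Lemma Lambda_unit_monomial m :
  Lambda E (unit_monomial m) = \sum_j Lambda E (eps j) *~ m j.
Proof.
by apply: Lambda_prod => j; have [unit_eps _] := eps_fund; have [] := unit_eps j.
Qed.

Lemma exponents_unique m m' :
  Lambda E (unit_monomial m) = Lambda E (unit_monomial m') -> m =1 m'.
Proof.
have [_ [_ eps_basis]] := eps_fund => Lmm'.
have [k [_ k_uniq]] := eps_basis _ (ex_intro2 _ _ _ (unit_monomial_unit m) erefl).
have km : k = [ffun j => m j].
  apply: k_uniq; rewrite Lambda_unit_monomial.
  by apply: eq_bigr => j _; rewrite ffunE.
have km' : k = [ffun j => m' j].
  apply: k_uniq; rewrite Lmm' Lambda_unit_monomial.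
  by apply: eq_bigr => j _; rewrite ffunE.
by move=> j; have := congr1 (fun f : {ffun 'I_r -> int} => f j) km'; rewrite km !ffunE.
Qed.

(** The coordinates of [Lambda u] in the basis of the unit lattice are the
    exponents; the remaining factor lies in the kernel of [Lambda], so it is a
    root of unity by Kronecker's theorem. *)
Lemma unit_decomposition u : unit_group u ->
  exists (m : 'I_r -> int) (z : K), roots_of_unity z /\ u = z * unit_monomial m.
Proof.
move=> unit_u; have [nz_u _ _] := unit_u; have [_ [_ eps_basis]] := eps_fund.
have [k [kE _]] := eps_basis _ (ex_intro2 _ _ _ unit_u erefl).
have unit_k := unit_monomial_unit k; have [nz_k _ _] := unit_k.
exists k, (u / unit_monomial k); split; last by rewrite mulfVK.
apply: (Lambda_eq0_root_of_unity (E := E)).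
  by apply: unit_groupM => //; exact: unit_groupV.
by rewrite LambdaM ?invr_eq0 // LambdaV // kE Lambda_unit_monomial subrr.
Qed.

Lemma generator_bounds y : I y ->
  [/\ y != 0, a y & `|ratr (field_norm y)| <= B * (ideal_norm a)%:R].
Proof.
have [I_fun _ _] := I_gen => Iy.
have [y' [int_y' nz_y' yy' sub_a le_norm]] := I_fun y Iy.
have [u unit_u yE] := principal_ideal_unit nz_y' yy'.
have [nz_u _ _] := unit_u; split.
- by rewrite yE mulf_neq0.
- by apply: sub_a; exists 1; [apply: (integral1 iZ) | rewrite mul1r].
- by rewrite yE ratr_field_norm_unit // -ideal_norm_field_norm // -yy'.
Qed.

Lemma g_set_sub : g_set E eps a B I `<=` C_set E eps a B.
Proof.
move=> g [m [y [Iy _ gE box_g]]]; have [nz_y ay leN] := generator_bounds Iy.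
have unit_m := unit_monomial_unit (fun j => m j 0); have [_ int_m _] := unit_m.
split=> //; first by rewrite gE; apply: (ideal_M a_ideal).
by rewrite gE ratr_field_norm_unit.
Qed.

Lemma g_set_neq0 g : g_set E eps a B I g -> g != 0.
Proof.
move=> [m [y [Iy _ -> _]]]; have [nz_y _ _] := generator_bounds Iy.
by apply: mulf_neq0 => //; have [] := unit_monomial_unit (fun j => m j 0).
Qed.

Lemma C_set0 : C_set E eps a B 0.
Proof.
split; first exact: (ideal_0 a_ideal).
  move=> v; rewrite completion_absE abs_place0.
  by rewrite mulr_ge0 ?powR_ge0 // expR_ge0.
by rewrite field_norm0 rmorph0 normr0 mulr_ge0 // ltW.
Qed.

Lemma finite_C_set : finite_set (C_set E eps a B).
Proof.
apply: sub_finite_set (finite_box E (fun v =>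
  (B * (ideal_norm a)%:R) `^ (degree K)%:R^-1 *
     expR (D_bound E eps v / (local_degree E v)%:R))).
move=> x [/(ideal_sub a_ideal) int_x box_x _]; split=> // v.
by have := box_x v; rewrite completion_absE.
Qed.

(** Two associate elements of [g_set] have the same generator [y], and then
    [Lambda], blind to roots of unity, recovers the exponents. *)
Lemma mu_orbit_inj :
  {in 0 |` g_set E eps a B I &, injective (@mu_orbit K)}.
Proof.
move=> g g' /set_mem Sg /set_mem Sg' /mu_orbit_eq[z root_z gE].
have unit_z := roots_of_unity_unit root_z; have [nz_z _ _] := unit_z.
case: Sg Sg' => [g0|Gg] [g'0|Gg'].
- by rewrite g0 g'0.
- by have := mulf_neq0 nz_z (g_set_neq0 Gg'); rewrite -gE g0 eqxx.
- by have := g_set_neq0 Gg; rewrite gE g'0 mulr0 eqxx.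
have [m [y [Iy _ gmy _]]] := Gg; have [m' [y' [Iy' _ gmy' _]]] := Gg'.
have [nz_y _ _] := generator_bounds Iy.
have unit_m := unit_monomial_unit (fun j => m j 0).
have unit_m' := unit_monomial_unit (fun j => m' j 0).
have yy' : y = y'.
  have [_ I_inj _] := I_gen; apply: I_inj; rewrite ?inE //.
  rewrite -(unit_principal_ideal y unit_m) -(unit_principal_ideal y' unit_m').
  by rewrite -gmy -gmy' gE unit_principal_ideal.
have mE : unit_monomial (fun j => m j 0) = z * unit_monomial (fun j => m' j 0).
  by apply: (mulIf nz_y); rewrite -gmy gE gmy' -yy' mulrA.
have [nz_m' _ _] := unit_m'.
have := congr1 (Lambda E) mE; rewrite LambdaM // (Lambda_root_of_unity _ root_z) add0r.
move/exponents_unique => mm'.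
by rewrite gmy gmy' -yy'; congr (_ * _); apply: eq_bigr => j _; rewrite mm'.
Qed.

(** The last inequality that defines the polytope bounds the coordinate at the
    last place, because the coordinates of a unit sum to zero. *)
Lemma mem_polytope x y (m : 'cV[int]_r) : x != 0 -> (0 < ideal_norm a)%N ->
  P_box eps a B (Phi E x) -> I y ->
  Lambda E x = Lambda E (unit_monomial (fun j => m j 0)) + Lambda E y ->
  U_polytope E eps a B I (T_matrix E eps *m map_mx intr m).
Proof.
move=> nz_x N_gt0 box_x Iy Lx; set u := unit_monomial _ in Lx.
have bound_u v : Lambda E u v 0 <= L_bound E eps a B I v.
  have := logarithmic_bound v B_gt0 N_gt0 nz_x box_x.
  rewrite Lx mxE /L_bound -lerBrDr => /le_trans; apply.
  by rewrite lerD2l lerN2 A_bound_le //; exact: finite_generator_set I_gen.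
have TE i : (T_matrix E eps *m map_mx intr m) i 0 = Lambda E u (lift ord_max i) 0.
  by rewrite mulmx_T_matrix Lambda_unit_monomial.
split=> [j|]; first by rewrite TE.
under eq_bigr do rewrite TE.
have := sum_Lambda_unit E (unit_monomial_unit (fun j => m j 0)).
rewrite (bigD1_ord ord_max) //= => /eqP.
by rewrite addrC addr_eq0 => /eqP ->; rewrite lerN2; apply: bound_u.
Qed.

Lemma mu_orbit_surj x : C_set E eps a B x ->
  exists2 g, (0 |` g_set E eps a B I) g & mu_orbit g = mu_orbit x.
Proof.
have [_ _ I_surj] := I_gen => Cx.
have [x0|nz_x] := eqVneq x 0; first by exists 0; [left | rewrite x0].
have [ax box_x leN] := Cx; have int_x := ideal_sub a_ideal ax.
have N_gt0 : (0 < ideal_norm a)%N.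
  rewrite lt0n; apply: contraTneq leN => ->; rewrite mulr0 -ltNge.
  exact: field_norm_gt0.
have [y Iy yx] : (@principal_ideal K @` I) (principal_ideal x).
  apply: I_surj; exists x; split=> //.
    by move=> _ [t int_t <-]; apply: (ideal_M a_ideal).
  by rewrite ideal_norm_field_norm.
have [nz_y _ _] := generator_bounds Iy.
have [u unit_u xE] := principal_ideal_unit nz_y (esym yx).
have [k [z [root_z uE]]] := unit_decomposition unit_u.
have [nz_z _ _] := roots_of_unity_unit root_z.
have [nz_k _ _] := unit_monomial_unit k.
have xzg : x = z * (unit_monomial k * y) by rewrite xE uE mulrA.
have kE : unit_monomial (fun j => (\col_j k j) j 0) = unit_monomial k.
  by apply: eq_bigr => j _; rewrite mxE.
exists (unit_monomial k * y); last by rewrite xzg (mu_orbitM _ root_z).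
right; exists (\col_j k j), y; split=> //.
- apply: (mem_polytope nz_x N_gt0 box_x Iy).
  by rewrite kE xzg !LambdaM ?mulf_neq0 // (Lambda_root_of_unity _ root_z) add0r.
- exact: (congr1 (fun e => e * y) (esym kE)).
- move=> v; have := box_x v; rewrite !completion_absE xzg abs_placeM.
  by rewrite abs_place_root_of_unity // mul1r.
Qed.

End Representatives.

Theorem proposition3p11 (R : realType) (K : fieldExtType rat) (r : nat)
    (E : arch_embeddings K R r) (r_ge1 : (1 <= r)%N)
    (a : set K) (a_ideal : is_ideal a) (a_neq0 : exists2 x, a x & x != 0)
    (B : R) (B_ge1 : 1 <= B)
    (eps : 'I_r -> K) (eps_fund : fundamental_units E eps)
    (I : set K) (I_gen : is_generator_set a B I) :
  finite_set (g_set E eps a B I) /\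
  complete_representatives (C_set E eps a B) (0 |` g_set E eps a B I).
Proof.
have B_gt0 : 0 < B by exact: lt_le_trans B_ge1.
have g_sub := g_set_sub a_ideal eps_fund I_gen.
have S_sub : 0 |` g_set E eps a B I `<=` C_set E eps a B.
  by move=> x [->|/g_sub //]; exact: C_set0.
split; first by apply: sub_finite_set g_sub _; exact: finite_C_set.
split=> //; split.
- by move=> g Sg; exists g => //; apply: S_sub.
- exact: mu_orbit_inj eps_fund I_gen.
- move=> _ [x Cx <-].
  by have [g Sg gx] := mu_orbit_surj a_ideal B_gt0 eps_fund I_gen Cx; exists g.
Qed.
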